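(* Let $R$ be a commutative ring and $n\ge 1$ an integer. Then the matrix ring $M_n(R)$ is a $U\sqrt{\Delta}$-ring if and only if $R$ is a local ring.
   Context: All rings are associative with identity $1\neq 0$. $M_n(R)$ is the ring of $n\times n$ matrices over $R$. For a ring $R$, $U(R)$ is its group of units, $\Delta(R)=\{x\in R \mid x+u\in U(R)\text{ for all }u\in U(R)\}$, and $\sqrt{\Delta(R)}=\{x\in R\mid x^n\in\Delta(R)\text{ for some integer }n\ge 1\}$. A ring $R$ is a $U\sqrt{\Delta}$-ring if every non-unit $a\in R$ can be written as $a=ub$ with $u\in U(R)$ and $b\in\sqrt{\Delta(R)}$. *)

(* Defs.v *)
From HB Require Import structures.
From mathcomp Require Import all_boot all_order all_algebra.

Set Implicit Arguments.
Unset Strict Implicit.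
Unset Printing Implicit Defensive.

Import GRing.Theory.
Local Open Scope ring_scope.

Definition in_Delta (R : unitRingType) (x : R) : Prop :=
  forall u : R, u \is a GRing.unit -> x + u \is a GRing.unit.

Definition in_sqrt_Delta (R : unitRingType) (x : R) : Prop :=
  exists2 n : nat, (1 <= n)%N & in_Delta (x ^+ n).

Definition U_sqrt_Delta_ring (R : unitRingType) : Prop :=
  forall a : R, a \isn't a GRing.unit ->
  exists u b : R, [/\ u \is a GRing.unit, in_sqrt_Delta b & a = u * b].

(* [idealr_closed] includes properness (1 \notin I).  Its argument is a        *)
(* boolean predicate; with the classical axioms every subset of R is one.      *)
Definition maximal_ideal (R : comNzRingType) (M : {pred R}) : Prop :=
  idealr_closed M /\
  forall I : {pred R}, idealr_closed I -> {subset M <= I} -> I =i M.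

(* Uniqueness is up to extensional equality [=i] of predicates.                *)
Definition local_ring (R : comNzRingType) : Prop :=
  exists2 M : {pred R}, maximal_ideal M &
    forall N : {pred R}, maximal_ideal N -> N =i M.

(* Main.v *)
Require Import Defs.
From HB Require Import structures.
From mathcomp Require Import all_boot all_order all_algebra.
From mathcomp Require Import perm boolp classical_sets.

(** A commutative ring is local exactly when its non-units are closed under
    addition ([local_ringP]), and both implications go through this criterion.

    Suppose the matrix ring has the factorisation property. If a is a non-unit
    of R, the scalar matrix a is a non-unit, so it is U * B with a power B^k in
    Delta. Scalar matrices being central, U and B commute and a^k = U^k B^k is
    in Delta as well; hence a^k - 1 is a unit and so is its divisor 1 - a
    ([U_sqrt_Delta_mx_local]). If x + y were a unit with x and y non-units, this
    would apply to a = x / (x + y) and make 1 - a = y / (x + y) a unit.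

    Suppose R is local. A matrix congruent to an invertible one modulo the
    maximal ideal is invertible, because its determinant is
    ([unitmx_perturb]); thus Delta contains all matrices with entries in the
    maximal ideal. Gaussian elimination with unit pivots writes any matrix as
    A = L I_r U + E with L, U invertible, I_r the truncated identity, and E with
    entries in the maximal ideal ([residual_rank_formP]). If A is not
    invertible then r is smaller than the size of the matrix, and I_r = P N
    with P a cyclic permutation and N a nilpotent truncated shift
    ([pid_mx_unit_nilpotent]). Therefore
      A = (L P U) (U^-1 N U + (L P U)^-1 E),
    and the second factor is nilpotent modulo the maximal ideal, so that one of
    its powers is in Delta. *)

Set Implicit Arguments.
Unset Strict Implicit.
Unset Printing Implicit Defensive.

Import GRing.Theory.
Local Open Scope ring_scope.

(** * Local rings and non-units *)

(** Krull's theorem, by Zorn's lemma. *)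
Lemma nonunit_maximal_ideal (R : comUnitRingType) (a : R) :
  a \isn't a GRing.unit -> exists2 M : {pred R}, maximal_ideal M & a \in M.
Proof.
move=> aNu.
pose proper_ideal_with_a (X : set R) :=
  [/\ X a, ~ X 1 & forall c u v, X u -> X v -> X (c * u + v)].
(* The empty set is let in because it is the union of the empty chain. *)
pose P (X : set R) := (exists x, X x) -> proper_ideal_with_a X.
have [F FP Ftot|A [PA Amax]] := @Zorn_bigcup R P.
  case=> x [X FX Xx]; split.
  - by exists X => //; have [] := FP X FX (ex_intro _ x Xx).
  - by case=> Y FY Y1; have [_ +] := FP Y FY (ex_intro _ 1 Y1).
  - move=> c u v [Y FY Yu] [Z FZ Zv].
    have [YZ|ZY] := Ftot Y Z FY FZ.
      exists Z => //; have [_ _] := FP Z FZ (ex_intro _ v Zv).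
      by apply=> //; apply: YZ.
    exists Y => //; have [_ _] := FP Y FY (ex_intro _ u Yu).
    by apply=> //; apply: ZY.
have aR_proper : proper_ideal_with_a [set x | exists c, x = c * a]%classic.
  split.
  - by exists 1; rewrite mul1r.
  - move=> [c ca1]; have := unitr1 R.
    by rewrite ca1 unitrM (negPf aNu) andbF.
  - by move=> c _ _ [d ->] [e ->]; exists (c * d + e); rewrite mulrDl mulrA.
(* The ideal generated by a rules out the empty set as a maximal element. *)
have A_neq0 : exists x, A x.
  apply: contrapT => A0; apply: (Amax [set x | exists c, x = c * a]%classic).
    split=> [x Ax|eqA]; first by case: A0; exists x.
    by apply: A0; exists a; apply: eqA; exists 1; rewrite mul1r.
  by move=> _; exact: aR_proper.
have [Aa A1 Alin] := PA A_neq0.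
exists (fun x => `[< A x >]); last exact/asboolP.
split=> [|I [I0 I1 Ilin] AI x].
  split.
  - by apply/asboolP; rewrite -(addNr a) -mulN1r; apply: Alin.
  - exact/asboolP.
  - by move=> c u v /asboolP Au /asboolP Av; apply/asboolP/Alin.
have sAI y : A y -> y \in I by move=> Ay; apply: AI; apply/asboolP.
apply/idP/asboolP => [Ix|]; last exact: sAI.
apply: contrapT => NAx; apply: (Amax [set y | y \in I]%classic).
  by split=> // sIA; apply: NAx; apply: sIA.
by move=> _; split=> /= [||c u v]; [exact: sAI|exact/negP|exact: Ilin].
Qed.

(** By Krull's theorem a unique maximal ideal contains every non-unit, so a sum
    of two non-units stays in a proper ideal. Conversely, if the non-units are
    additively closed they form an ideal, which contains every proper ideal. *)
Lemma local_ringP (R : comUnitRingType) :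
  local_ring R <->
  (forall x y : R, x \isn't a GRing.unit -> y \isn't a GRing.unit ->
     x + y \isn't a GRing.unit).
Proof.
split=> [[M [[M0 M1 Mlin] _] Muniq] x y xNu yNu|nuD].
  have inM z : z \isn't a GRing.unit -> z \in M.
    by move=> /nonunit_maximal_ideal[N /Muniq <-].
  apply/negP=> xyu; case/negP: M1.
  rewrite -(mulVr xyu) -[_ * _]addr0. apply: (Mlin) => //.
  by rewrite -[x]mul1r; apply: Mlin; apply: inM.
pose nu : {pred R} := fun x => x \isn't a GRing.unit.
have nuE x : (x \in nu) = (x \isn't a GRing.unit) by [].
have nuI : idealr_closed nu.
  split; first by rewrite nuE unitr0.
    by rewrite nuE unitr1.
  move=> a u v; rewrite !nuE => uNu vNu; apply: nuD => //.
  by rewrite unitrM (negPf uNu) andbF.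
have sub_nu (I : {pred R}) : idealr_closed I -> {subset I <= nu}.
  case=> I0 I1 Ilin x Ix; apply/negP=> xu; case/negP: I1.
  by rewrite -(mulVr xu) -[_ * _]addr0; apply: Ilin.
exists nu => [|N [NI Nmax]].
  split=> // I II nuI' x; apply/idP/idP; [exact: sub_nu|exact: nuI'].
by move=> x; rewrite (Nmax nu nuI (sub_nu _ NI)).
Qed.

(** * From matrices to the base ring *)

(** Because u * x + v = u * (x + u^-1 * v), translation by u * x reduces to
    translation by x. *)
Lemma in_DeltaM (R : unitRingType) (u x : R) :
  u \is a GRing.unit -> in_Delta x -> in_Delta (u * x).
Proof.
move=> uu dx v vu; rewrite -[v](mulVKr uu) -mulrDr unitrMr //.
by apply: dx; rewrite unitrMr ?unitrV.
Qed.

(** When [a%:M = U * B], centrality of [a%:M] makes [U] and [B] commute, so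
    [(a ^+ k)%:M = U ^+ k * B ^+ k] inherits membership in Delta from
    [B ^+ k].  Then [a ^+ k - 1] is a unit, and [1 - a] divides it up to
    sign. *)
Lemma U_sqrt_Delta_mx_local (R : comUnitRingType) (n : nat) :
  U_sqrt_Delta_ring 'M[R]_n.+1 ->
  forall a : R, a \isn't a GRing.unit -> 1 - a \is a GRing.unit.
Proof.
move=> HR a aNu.
have scalar_unit (b : R) :
    ((b%:M : 'M[R]_n.+1) \is a GRing.unit) = (b \is a GRing.unit).
  by rewrite -[LHS]/(_ \in unitmx) unitmxE det_scalar unitrX_pos.
have [|U [B [Uu [k k_gt0 Bk] aUB]]] := HR (a%:M); first by rewrite scalar_unit.
have comUB : GRing.comm U B.
  apply: (mulrI Uu); rewrite -aUB [RHS]mulrA -aUB.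
  by rewrite -[LHS]/(_ *m _) -[RHS]/(_ *m _) scalar_mxC.
have dak : in_Delta (((a ^+ k)%:M : 'M[R]_n.+1)).
  by rewrite rmorphXn /= aUB exprMn_comm //; apply: in_DeltaM; rewrite ?unitrX.
have := dak (- 1); rewrite unitrN unitr1 => /(_ isT).
rewrite -[1]/((1%R : R)%:M) -raddfB /= scalar_unit subrX1 unitrM => /andP[+ _].
by rewrite -unitrN opprB.
Qed.

(** * Truncated identities are unit multiples of nilpotent matrices *)

Lemma strictly_lower_nilpotent (R : pzRingType) (n : nat) (N : 'M[R]_n.+1) :
  (forall i j : 'I_n.+1, (i <= j)%N -> N i j = 0) -> N ^+ n.+1 = 0.
Proof.
move=> N0.
(* Each extra factor of N lowers the highest possibly nonzero diagonal by one. *)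
suff Nk k (i j : 'I_n.+1) : (i < j + k)%N -> (N ^+ k) i j = 0.
  by apply/matrixP=> i j; rewrite mxE Nk // ltn_addl.
elim: k i j => [|k IHk] i j.
  by rewrite addn0 => ij; rewrite expr0 mxE -val_eqE /= ltn_eqF.
rewrite addnS ltnS => ij; rewrite exprS mxE big1 // => l _.
have [il|li] := leqP i l; first by rewrite N0 // mul0r.
by rewrite IHk ?mulr0 // (leq_trans li).
Qed.

(** As r <= n, the truncated identity kills the last basis vector, so composing
    it with a cyclic shift of the basis gives a truncated shift along the
    subdiagonal that never wraps around, hence is nilpotent; the cyclic shift
    is invertible and can be undone. *)
Lemma pid_mx_unit_nilpotent (R : comUnitRingType) (n r : nat) :
  (r <= n)%N -> exists P N : 'M[R]_n.+1,
    [/\ P \is a GRing.unit, N ^+ n.+1 = 0 & pid_mx r = P * N].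
Proof.
move=> rn.
pose N : 'M[R]_n.+1 :=
  \matrix_(i, j) ((i == j.+1 :> nat) && (j < r)%N)%:R.
exists (perm_mx (perm (@ordS_inj n.+1))), N; split.
- exact: unitmx_perm.
- apply: strictly_lower_nilpotent => i j ij; rewrite mxE.
  by rewrite ltn_eqF.
rewrite -[_ * _]/(_ *m _) -row_permE; apply/matrixP=> i j.
rewrite !mxE permE /=.
have -> : (i == j :> nat) && (i < r)%N = (i == j :> nat) && (j < r)%N.
  by case: eqP => // ->.
have [jr|_] := ltnP j r; last by rewrite !andbF.
rewrite !andbT; congr (_%:R); move: (ltn_ord i); rewrite ltnS leq_eqVlt.
(* Row n is the only one where the shift wraps around, to row 0, which is zero
   in N. *)
case/predU1P => [->|i_lt_n]; last by rewrite modn_small.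
by rewrite modnn gtn_eqF // (leq_trans jr).
Qed.

(** * Matrices over a local ring *)

(* The matrices with entries in the maximal ideal play the role of zero: they
   allow the linear algebra of the residue field to be done in R itself. *)
Section LocalMatrices.
Variable R : comUnitRingType.
Hypothesis nuD : forall x y : R,
  x \isn't a GRing.unit -> y \isn't a GRing.unit -> x + y \isn't a GRing.unit.

Definition nonunit_mx m n (A : 'M[R]_(m, n)) :=
  forall i j, A i j \isn't a GRing.unit.

Lemma nonunitM (x y : R) : y \isn't a GRing.unit -> x * y \isn't a GRing.unit.
Proof. by move=> yNu; rewrite unitrM (negPf yNu) andbF. Qed.

Lemma nonunit_mxD m n (A B : 'M[R]_(m, n)) :
  nonunit_mx A -> nonunit_mx B -> nonunit_mx (A + B).
Proof. by move=> HA HB i j; rewrite mxE; apply: nuD. Qed.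

Lemma nonunit_sum I (s : seq I) (F : I -> R) :
  (forall i, F i \isn't a GRing.unit) -> \sum_(i <- s) F i \isn't a GRing.unit.
Proof. by move=> HF; elim/big_ind: _ => //; rewrite unitr0. Qed.

Lemma nonunit_mulmxl m n p (A : 'M[R]_(m, n)) (B : 'M[R]_(n, p)) :
  nonunit_mx B -> nonunit_mx (A *m B).
Proof.
by move=> HB i j; rewrite mxE; apply: nonunit_sum => k; apply: nonunitM.
Qed.

Lemma nonunit_mulmxr m n p (A : 'M[R]_(m, n)) (B : 'M[R]_(n, p)) :
  nonunit_mx A -> nonunit_mx (A *m B).
Proof.
move=> HA i j; rewrite mxE; apply: nonunit_sum => k.
by rewrite mulrC; apply: nonunitM.
Qed.

(** The determinant is a polynomial in the entries, and congruence modulo the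
    ideal of non-units is compatible with products and sums. *)
Lemma nonunit_detB n (A B : 'M[R]_n) :
  nonunit_mx (A - B) -> \det A - \det B \isn't a GRing.unit.
Proof.
move=> AB; rewrite /determinant -sumrB; apply: nonunit_sum => s.
rewrite -mulrBr; apply: nonunitM.
apply: (big_ind2 (fun x y => x - y \isn't a GRing.unit)).
- by rewrite subrr unitr0.
- move=> x1 x2 y1 y2 Hx Hy.
  have -> : x1 * y1 - x2 * y2 = y1 * (x1 - x2) + x2 * (y1 - y2).
    by rewrite !mulrBr addrA [y1 * x1]mulrC [y1 * x2]mulrC subrK.
  by apply: nuD; apply: nonunitM.
- by move=> i _; have := AB i (s i); rewrite !mxE.
Qed.

Lemma unitmx_perturb n (U E : 'M[R]_n) :
  U \in unitmx -> nonunit_mx E -> U + E \in unitmx.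
Proof.
rewrite !unitmxE => Uu HE; apply/negPn/negP => UENu.
have UUE : nonunit_mx (U - (U + E)).
  by move=> i j; rewrite opprD addrA subrr add0r mxE unitrN.
by have := nuD (nonunit_detB UUE) UENu; rewrite subrK Uu.
Qed.

Lemma nonunit_mx_Delta n (E : 'M[R]_n.+1) : nonunit_mx E -> in_Delta E.
Proof. by move=> HE U Uu; rewrite addrC; apply: unitmx_perturb. Qed.

(** Modulo the two-sided ideal of matrices with non-unit entries, [N + E] and
    [N] have the same powers. *)
Lemma nonunit_mxX n (N E : 'M[R]_n.+1) k :
  nonunit_mx E -> nonunit_mx ((N + E) ^+ k - N ^+ k).
Proof.
move=> HE; elim: k => [|k IHk].
  by rewrite !expr0 subrr => i j; rewrite mxE unitr0.
have -> : (N + E) ^+ k.+1 - N ^+ k.+1 =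
    N * ((N + E) ^+ k - N ^+ k) + E * (N + E) ^+ k.
  by rewrite !exprS mulrDl mulrBr addrAC.
by apply: nonunit_mxD; [apply: nonunit_mulmxl|apply: nonunit_mulmxr].
Qed.

(** Rank factorisation over the residue field, lifted to R: the error term [E]
    absorbs everything that vanishes in the residue field. *)
Definition residual_rank_form m (A : 'M[R]_m) :=
  exists L U E : 'M[R]_m, exists r : nat,
  [/\ L \in unitmx, U \in unitmx, (r <= m)%N, nonunit_mx E
    & A = L *m pid_mx r *m U + E].

Lemma residual_rank_form_equiv m (V A W : 'M[R]_m) :
  V \in unitmx -> W \in unitmx -> residual_rank_form A ->
  residual_rank_form (V *m A *m W).
Proof.
move=> Vu Wu [L [U [E [r [Lu Uu rm HE ->]]]]].
exists (V *m L), (U *m W), (V *m E *m W), r; split=> //.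
- by rewrite unitmx_mul Vu.
- by rewrite unitmx_mul Uu.
- exact/nonunit_mulmxr/nonunit_mulmxl.
- by rewrite mulmxDr mulmxDl !mulmxA.
Qed.

Lemma residual_rank_form_block m (S : 'M[R]_m) :
  residual_rank_form S -> residual_rank_form (block_mx (1%:M : 'M_1) 0 0 S).
Proof.
move=> [L [U [E [r [Lu Uu rm HE ->]]]]].
exists (block_mx 1%:M 0 0 L), (block_mx 1%:M 0 0 U), (block_mx 0 0 0 E), r.+1.
split=> //.
- by rewrite unitmxE det_ublock det1 mul1r.
- by rewrite unitmxE det_ublock det1 mul1r.
- by move=> i j; rewrite !mxE; do 2?[case: splitP => ? _; rewrite ?mxE ?unitr0 //].
have -> : pid_mx r.+1 = block_mx (1%:M : 'M_1) 0 0 (pid_mx r) :> 'M[R]_(1 + m).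
  apply/matrixP=> i j; rewrite !mxE.
  do 2![case: splitP => ? ->; rewrite ?mxE ?ord1 //=].
rewrite !mulmx_block !(mulmx0, mul0mx, mulmx1, addr0, add0r).
by rewrite add_block_mx !addr0.
Qed.

(** One step of Gaussian elimination: a unit in the corner clears its row and
    column, leaving the Schur complement [S]. *)
Lemma residual_rank_form_pivot m (A : 'M[R]_(1 + m)) :
  (forall S : 'M[R]_m, residual_rank_form S) -> A 0 0 \is a GRing.unit ->
  residual_rank_form A.
Proof.
move=> IHm a_u; set a := A 0 0 in a_u.
pose S := drsubmx A - a^-1 *: (dlsubmx A *m ursubmx A).
have -> : A = block_mx a%:M 0 (dlsubmx A) 1%:M *m block_mx 1%:M 0 0 S
                *m block_mx 1%:M (a^-1 *: ursubmx A) 0 1%:M.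
  rewrite !mulmx_block !(mulmx0, mul0mx, mulmx1, mul1mx, addr0, add0r).
  rewrite -!scalemxAr mul_scalar_mx scalerA mulVr // scale1r [_ + S]subrKC.
  rewrite -[LHS]submxK; congr block_mx.
  by rewrite [LHS]mx11_scalar !mxE; congr (A _ _)%:M; apply: val_inj.
apply: residual_rank_form_equiv; last exact: residual_rank_form_block.
  by rewrite unitmxE det_lblock det1 mulr1 det_scalar1.
by rewrite unitmxE det_ublock !det1 mulr1 unitr1.
Qed.

(** Gaussian elimination can pivot on any unit entry, and it only stops when
    all the remaining entries are non-units, that is, belong to the error. *)
Lemma residual_rank_formP m (A : 'M[R]_m) : residual_rank_form A.
Proof.
elim: m A => [|m IHm] A.
  exists 1%:M, 1%:M, 0, 0%N; split; rewrite ?unitmx1 //; first by case.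
  by apply/matrixP; case.
have [/existsP[i /existsP[j Aij]]|/existsPn noU] :=
    boolP [exists i, exists j, A i j \is a GRing.unit]; last first.
  exists 1%:M, 1%:M, A, 0%N; split; rewrite ?unitmx1 //.
    by move=> i j; have /existsPn := noU i; apply.
  by rewrite pid_mx_0 mulmx0 mul0mx add0r.
have -> : A = tperm_mx i 0 *m xcol j 0 (xrow i 0 A) *m tperm_mx j 0.
  rewrite xcolE xrowE !mulmxA -[RHS]mulmxA -!perm_mxM !tperm2 perm_mx1.
  by rewrite mul1mx mulmx1.
apply: residual_rank_form_equiv; rewrite ?unitmx_perm //.
by apply: residual_rank_form_pivot => //; rewrite !mxE !tpermR.
Qed.

(** With [A = L * pid_mx r * U + E] and [pid_mx r = P * N], conjugating the
    nilpotent [N] by [U] gives [A = V * (U^-1 * N * U + V^-1 * E)] for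
    [V = L * P * U]. The second factor is nilpotent up to non-unit entries, so
    a power of it has only non-unit entries and is in Delta. *)
Lemma local_U_sqrt_Delta_mx n : U_sqrt_Delta_ring 'M[R]_n.+1.
Proof.
move=> A ANu; have [L [U [E [r [Lu Uu rn HE defA]]]]] := residual_rank_formP A.
(* Full residual rank would make A invertible. *)
have {}rn : (r <= n)%N.
  rewrite -ltnS ltn_neqAle rn andbT; apply: contra ANu => /eqP rn1.
  rewrite defA rn1 pid_mx_1 mulmx1.
  by apply: unitmx_perturb; rewrite ?unitmx_mul ?Lu.
have [P [N [Pu N0 defPN]]] := pid_mx_unit_nilpotent R rn.
pose V : 'M[R]_n.+1 := L * P * U.
have Vu : V \is a GRing.unit by rewrite unitrMl ?unitrMl.
exists V, (U^-1 * N * U + V^-1 * E); split=> //.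
  exists n.+1 => //; apply: nonunit_mx_Delta.
  have UNU : (U^-1 * N * U) ^+ n.+1 = 0.
    suff -> k : (U^-1 * N * U) ^+ k = U^-1 * N ^+ k * U.
      by rewrite N0 mulr0 mul0r.
    elim: k => [|k IHk]; first by rewrite !expr0 mulr1 mulVr.
    by rewrite !exprSr IHk !mulrA mulrK.
  rewrite -[X in nonunit_mx X]subr0 -UNU; apply: nonunit_mxX.
  exact: nonunit_mulmxl.
rewrite mulrDr mulVKr // defA defPN.
congr (_ + _).
by rewrite -[LHS]/(L * (P * N) * U) /V !mulrA mulrK.
Qed.

End LocalMatrices.

Theorem corollary3p2 (R : comUnitRingType) (n : nat) :
  U_sqrt_Delta_ring 'M[R]_n.+1 <-> local_ring R.
Proof.
rewrite local_ringP; split=> [HR x y xNu yNu|nuD]; last first.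
  exact: local_U_sqrt_Delta_mx.
apply/negP=> xyu.
have : x / (x + y) \isn't a GRing.unit by rewrite unitrMl ?unitrV.
move/(U_sqrt_Delta_mx_local HR).
rewrite -{1}(mulrV xyu) -mulrBl unitrMl ?unitrV // addrC addKr.
exact/negP.
Qed.
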